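(* Let $p$ be a prime. The map $\chi:\mathrm{Div}(C_p)\to H_p/(p-1)H_p\simeq\mathbb{Z}/(p-1)\mathbb{Z}$, $D\mapsto\chi(D)$, vanishes on principal divisors, and it induces an isomorphism of groups $\chi:J(C_p)\to\mathbb{Z}/(p-1)\mathbb{Z}$, where $J(C_p)=\mathrm{Div}(C_p)^0/\mathcal{P}$ is the quotient of the group $\mathrm{Div}(C_p)^0$ of divisors of degree $0$ on $C_p$ by the subgroup $\mathcal{P}$ of principal divisors.
   Context: Let $p$ be a prime and $H_p=\mathbb{Z}[1/p]\subset\mathbb{Q}$ the group of fractions whose denominator is a power of $p$. $C_p$ is the set of subgroups $H\subset\mathbb{R}$ which are abstractly isomorphic to $H_p$; the map $\lambda\mapsto\lambda H_p$ identifies $\mathbb{R}_+^*/p^{\mathbb{Z}}$ with $C_p$. $\mathcal{K}_p$ is the sheaf on the circle $\mathbb{R}_+^*/p^{\mathbb{Z}}$ of continuous functions with values in $\mathbb{R}_{\max}=\mathbb{R}\cup\{-\infty\}$ that are piecewise affine in the variable $\lambda\in\mathbb{R}_+^*$ with slopes in $H_p$ (or constantly $-\infty$), with operations max and $+$. Thus a global section $f\ne-\infty$ is a continuous, piecewise affine function $f:\mathbb{R}_+^*\to\mathbb{R}$ with slopes in $H_p$ and $f(p\lambda)=f(\lambda)$ for all $\lambda$. For such $f$ and $H=\lambda H_p$, the order of $f$ at $H$ is $\mathrm{Order}(f)(H)=\lambda\big(f'^+(\lambda)-f'^-(\lambda)\big)\in H$, where $f'^{\pm}$ are the right and left derivatives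 (independent of the choice of $\lambda$ with $H=\lambda H_p$). A divisor $D$ on $C_p$ is a map assigning to each $H\in C_p$ an element $D(H)\in H\subset\mathbb{R}$, zero except for finitely many $H$; divisors form a group $\mathrm{Div}(C_p)$ under pointwise addition. The degree is $\deg(D)=\sum_{H\in C_p}D(H)\in\mathbb{R}$. The principal divisors are the divisors $(f)$, $(f)(H)=\mathrm{Order}(f)(H)$, for global sections $f\neq-\infty$ of $\mathcal{K}_p$. For $H\in C_p$, choose $\lambda\in\mathbb{R}_+^*$ with $H=\lambda H_p$; the map $\chi:H\to H_p/(p-1)H_p\simeq\mathbb{Z}/(p-1)\mathbb{Z}$ sends $h$ to the class of $\lambda^{-1}h$. It does not depend on the choice of $\lambda$, since different choices differ by a power of $p$. For a divisor $D$ one sets $\chi(D)=\sum_{H\in C_p}\chi(D(H))\in\mathbb{Z}/(p-1)\mathbb{Z}$. *)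

(* Defs.v *)
From HB Require Import structures.
From mathcomp Require Import all_boot all_order all_algebra ring_quotient ring.
From mathcomp Require Import all_classical all_reals all_analysis.
Import Order.TTheory GRing.Theory Num.Theory numFieldNormedType.Exports.

Set Implicit Arguments.
Unset Strict Implicit.
Unset Printing Implicit Defensive.

Local Open Scope classical_set_scope.
Local Open Scope ring_scope.
Local Open Scope quotient_scope.

Section ScalingSite.
Variables (R : realType) (p : nat).

(* Z[1/p]; for p = 0 the conventions n / 0 = 0 and 0 ^+ 0 = 1 make it Z. *)
Definition Hp_pred : {pred R} :=
  fun x => `[< exists (a : int) (k : nat), x = a%:~R / p%:R ^+ k >].

Lemma Hp_predP x :
  reflect (exists (a : int) (k : nat), x = a%:~R / p%:R ^+ k) (x \in Hp_pred).
Proof. exact: asboolP. Qed.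

Lemma Hp_zmod_closed : zmod_closed Hp_pred.
Proof.
split=> [|x y /Hp_predP[a [k ->]] /Hp_predP[b [l ->]]]; apply/Hp_predP.
  by exists 0, 0%N; rewrite mul0r.
have [->|p0] := eqVneq p 0%N.
  have H (m : int) n : exists c : int, m%:~R / (0%:R : R) ^+ n = c%:~R.
    case: n => [|n]; first by exists m; rewrite expr0 divr1.
    by exists 0; rewrite expr0n /= invr0 mulr0.
  have [c ->] := H a k; have [d ->] := H b l.
  by exists (c - d), 0%N; rewrite expr0 divr1 rmorphB.
have u n : (p%:R ^+ n : R) != 0 by rewrite expf_neq0// pnatr_eq0.
exists (a * p%:Z ^+ l - b * p%:Z ^+ k), (k + l)%N.
have -> : (a * p%:Z ^+ l - b * p%:Z ^+ k)%:~R =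
    a%:~R * p%:R ^+ l - b%:~R * p%:R ^+ k :> R.
  by rewrite rmorphB /= !intrM !rmorphXn.
by rewrite exprD; field; rewrite !u.
Qed.

HB.instance Definition _ := GRing.isZmodClosed.Build R Hp_pred Hp_zmod_closed.

Definition Hp : Type := {x : R | x \in Hp_pred}.
HB.instance Definition _ := SubChoice.on Hp.
HB.instance Definition _ := [SubChoice_isSubZmodule of Hp by <:].

Definition pm1Hp : {pred Hp} := fun x => `[< exists y : Hp, x = y *+ p.-1 >].

Lemma pm1Hp_zmod_closed : zmod_closed pm1Hp.
Proof.
split=> [|x y /asboolP[x' ->] /asboolP[y' ->]]; apply/asboolP.
  by exists 0; rewrite mul0rn.
by exists (x' - y'); rewrite mulrnBl.
Qed.

HB.instance Definition _ := GRing.isZmodClosed.Build Hp pm1Hp pm1Hp_zmod_closed.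

Definition HpQ : Type := Quotient.quot pm1Hp.
HB.instance Definition _ := Choice.on HpQ.
HB.instance Definition _ := GRing.Zmodule.on HpQ.
HB.instance Definition _ := ZmodQuotient.on HpQ.

Definition Cp : set (set R) := [set H | [/\ H 0,
  forall x y, H x -> H y -> H (x - y) &
  exists phi : {additive Hp -> R}, set_bij [set: Hp] H phi]].

Definition scaleHp (l : R) : set R := [set l * x | x in [set` Hp_pred]].

Lemma Hp_frac (x : Hp) :
  exists2 n : nat, (0 < n)%N & exists a : int, val x * n%:R = a%:~R.
Proof.
have /Hp_predP[a [k xE]] := valP x; rewrite xE.
have [p0|p0] := posnP p; last first.
  exists (p ^ k)%N; first by rewrite expn_gt0 p0.
  by exists a; rewrite natrX divfK// expf_neq0// pnatr_eq0 -lt0n.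
exists 1%N => //; case: k {xE} => [|k]; first by exists a; rewrite expr0 divr1 mulr1.
by exists 0; rewrite p0 exprS mul0r invr0 mulr0 mul0r.
Qed.

Lemma Hp_one_subproof : (1 : R) \in Hp_pred.
Proof. by apply/Hp_predP; exists 1, 0%N; rewrite divr1. Qed.

Lemma Hp_additiveE (phi : {additive Hp -> R}) :
  exists c : R, forall x : Hp, phi x = c * val x.
Proof.
pose one : Hp := exist _ 1 Hp_one_subproof.
exists (phi one) => x; have [n n0 [a xna]] := Hp_frac x.
have n0' : (n%:R : R) != 0 by rewrite pnatr_eq0 -lt0n.
apply: (mulIf n0'); rewrite mulr_natr -raddfMn/= -mulrA xna.
rewrite mulrzr -raddfMz; congr (phi _); apply: val_inj.
by rewrite raddfMn raddfMz /= -mulr_natr xna.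
Qed.

Lemma Cp_scaleHp (H : Cp) : exists l : R, 0 < l /\ val H = scaleHp l.
Proof.
have [_ _ [phi [phiH phi_inj phi_surj]]] := set_mem (valP H).
have [c phiE] := Hp_additiveE phi.
have HE : val H = scaleHp c.
  apply/seteqP; split => [y /phi_surj[x _ <-]|_ [x xHp <-]].
    by exists (val x); [exact: valP|rewrite phiE].
  by rewrite -[x]/(val (exist _ x xHp : Hp)) -phiE; exact: phiH.
have c0 : c != 0.
  apply/eqP => c0; pose one : Hp := exist _ 1 Hp_one_subproof.
  have /(congr1 val)/eqP : one = 0.
    by apply: phi_inj; rewrite ?inE// !phiE c0 !mul0r.
  by rewrite /= oner_eq0.
exists `|c|; split; first by rewrite normr_gt0.
rewrite HE; case: (ger0P c) => // _; apply/seteqP.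
split=> _ [x xHp <-]; exists (- x); rewrite ?mulrNN ?mulrN ?mulNr//;
  by rewrite /mkset rpredN.
Qed.

(* A choice of l > 0 with H = l Hp. *)
Definition gen (H : Cp) : R := projT1 (cid (Cp_scaleHp H)).

Lemma gen_gt0 (H : Cp) : 0 < gen H.
Proof. by rewrite /gen; case: cid => l []. Qed.

Lemma gen_scaleHp (H : Cp) : val H = scaleHp (gen H).
Proof. by rewrite /gen; case: cid => l []. Qed.

Definition divisor_pred : {pred (Cp -> R)} := fun D =>
  `[< (forall H : Cp, val H (D H)) /\ finite_set [set H | D H != 0] >].

Lemma divisor_zmod_closed : zmod_closed divisor_pred.
Proof.
split=> [|D E /asboolP[Dm Df] /asboolP[Em Ef]]; apply/asboolP; split.
- by move=> H; case: (set_mem (valP H)).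
- by rewrite (_ : mkset _ = set0)// -subset0 => H /=; rewrite eqxx.
- by move=> H; have [_ + _] := set_mem (valP H); apply.
- apply: (@sub_finite_set _ _ ([set H | D H != 0] `|` [set H | E H != 0])).
    move=> H /= DE; have [D0|] := eqVneq (D H) 0; last by left.
    by right; apply: contra_neq DE => E0; rewrite -[LHS]/(D H - E H) D0 E0 subrr.
  by rewrite finite_setU.
Qed.

HB.instance Definition _ :=
  GRing.isZmodClosed.Build (Cp -> R) divisor_pred divisor_zmod_closed.

Definition Div : Type := {D : Cp -> R | D \in divisor_pred}.
HB.instance Definition _ := SubChoice.on Div.
HB.instance Definition _ := [SubChoice_isSubZmodule of Div by <:].

Lemma div_mem (D : Div) (H : Cp) : val H (val D H).
Proof. by have /asboolP[] := valP D. Qed.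

Lemma div_finite (D : Div) : finite_set [set H | val D H != 0].
Proof. by have /asboolP[] := valP D. Qed.

Definition deg (D : Div) : R := \sum_(H \in [set: Cp]) val D H.

Lemma deg_is_zmod_morphism : zmod_morphism deg.
Proof.
move=> D E; rewrite /deg.
set A := [set H | val D H != 0] `|` [set H | val E H != 0].
have Af : finite_set A by rewrite finite_setU; split; exact: div_finite.
have w (F : Cp -> R) : (forall H, ~ A H -> F H = 0) ->
    \sum_(H \in [set: Cp]) F H = \sum_(H \in A) F H.
  by move=> F0; rewrite (@fsbig_widen _ _ _ _ A setT)// => H [_] /F0.
have nA H : ~ A H -> val D H = 0 /\ val E H = 0.
  move=> /not_orP[/negP + /negP]; rewrite !negbK => /eqP -> /eqP ->.
  by [].
rewrite (w (val D)) => [|H /nA[]//]; rewrite (w (val E)) => [|H /nA[]//].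
rewrite w => [|H /nA[D0 E0]]; last first.
  by rewrite raddfB /= -[LHS]/(val D H - val E H) D0 E0 subrr.
by rewrite !fsbig_finite//= -sumrB.
Qed.

HB.instance Definition _ :=
  GRing.isZmodMorphism.Build Div R deg deg_is_zmod_morphism.

Definition deg0_pred : {pred Div} := fun D => deg D == 0.

Lemma deg0_zmod_closed : zmod_closed deg0_pred.
Proof.
have P D : reflect (deg D = 0) (D \in deg0_pred) by exact: eqP.
split=> [|D E /P D0 /P E0]; apply/P; first exact: raddf0.
by rewrite raddfB/= D0 E0 subrr.
Qed.

HB.instance Definition _ :=
  GRing.isZmodClosed.Build Div deg0_pred deg0_zmod_closed.

Definition Div0 : Type := {D : Div | D \in deg0_pred}.
HB.instance Definition _ := SubChoice.on Div0.
HB.instance Definition _ := [SubChoice_isSubZmodule of Div0 by <:].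

Lemma gen_inv_mem (H : Cp) (h : R) : val H h -> (gen H)^-1 * h \in Hp_pred.
Proof.
rewrite gen_scaleHp => -[x xHp <-].
by rewrite mulKf// gt_eqF// gen_gt0.
Qed.

Definition chi_at (H : Cp) (h : R) (hH : val H h) : HpQ :=
  \pi_HpQ (exist _ ((gen H)^-1 * h) (gen_inv_mem hH) : Hp).

Definition chi (D : Div) : HpQ := \sum_(H \in [set: Cp]) chi_at (div_mem D H).

(* [B] contains the break points of [f] between [a] and [b]. *)
Definition piecewise_affine (f : R -> R) := forall a b : R, 0 < a -> a < b ->
  exists B : seq R, forall x y : R, a <= x -> x < y -> y <= b ->
    (forall t, t \in B -> ~~ (x < t < y)) ->
  exists2 s : R, s \in Hp_pred &
    forall t, x <= t <= y -> f t = f x + s * (t - x).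

(* The sections other than the constant -oo; only the values of [f] on positive
   reals are meaningful. *)
Definition global_section (f : R -> R) := [/\
  forall l, 0 < l -> {for l, continuous f},
  piecewise_affine f &
  forall l, 0 < l -> f (p%:R * l) = f l].

Definition rderive (f : R -> R) (l : R) : R :=
  lim ((f x - f l) / (x - l) @[x --> l^'+]).

Definition lderive (f : R -> R) (l : R) : R :=
  lim ((f x - f l) / (x - l) @[x --> l^'-]).

Definition Order (f : R -> R) (H : Cp) : R :=
  gen H * (rderive f (gen H) - lderive f (gen H)).

Definition principal (D : Div) :=
  exists2 f : R -> R, global_section f & forall H : Cp, val D H = Order f H.

Lemma no_break_right (B : seq R) (l u : R) : l < u ->
  exists y, [/\ l < y, y <= u & forall t, t \in B -> ~~ (l < t < y)].
Proof.
move=> lu; elim: B => [|b B [y [ly yu yB]]]; first by exists u.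
have [lb|bl] := ltP l b; last first.
  exists y; split=> // t; rewrite inE => /predU1P[->|/yB//].
  by rewrite ltNge bl.
exists (Num.min b y); split; first by rewrite lt_min lb ly.
  by rewrite ge_min yu orbT.
move=> t; rewrite inE lt_min => /predU1P[->|/yB]; first by rewrite ltxx andbF.
by apply: contra => /and3P[-> _ ->].
Qed.

Lemma no_break_left (B : seq R) (l u : R) : u < l ->
  exists y, [/\ y < l, u <= y & forall t, t \in B -> ~~ (y < t < l)].
Proof.
move=> lu; elim: B => [|b B [y [ly yu yB]]]; first by exists u.
have [lb|bl] := ltP b l; last first.
  exists y; split=> // t; rewrite inE => /predU1P[->|/yB//].
  by rewrite (ltNge b) bl andbF.
exists (Num.max b y); split; first by rewrite gt_max lb ly.
  by rewrite le_max yu orbT.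
move=> t; rewrite inE gt_max => /predU1P[->|/yB]; first by rewrite ltxx.
by apply: contra => /andP[/andP[_ ->] ->].
Qed.

Lemma piecewise_affine_right f l : piecewise_affine f -> 0 < l ->
  exists2 s : R, s \in Hp_pred &
    exists2 y, l < y & forall t, l <= t <= y -> f t = f l + s * (t - l).
Proof.
move=> fpa l0; have ll1 : l < l + 1 by rewrite ltrDl.
have [B BP] := fpa _ _ l0 ll1; have [y [ly yl1 yB]] := no_break_right B ll1.
by have [s sHp fs] := BP _ _ (lexx _) ly yl1 yB; exists s => //; exists y.
Qed.

Lemma piecewise_affine_left f l : piecewise_affine f -> 0 < l ->
  exists2 s : R, s \in Hp_pred &
    exists2 y, y < l & forall t, y <= t <= l -> f t = f l + s * (t - l).
Proof.
move=> fpa l0; have l2 : l / 2 < l by rewrite ltr_pdivrMr// ltr_pMr// ltr1n.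
have [|B BP] := fpa _ _ _ l2; first by rewrite divr_gt0.
have [y [yl ly yB]] := no_break_left B l2.
have [s sHp fs] := BP _ _ ly yl (lexx _) yB; exists s => //; exists y => // t.
by move=> yt; rewrite (fs _ yt) (fs l) ?lexx ?ltW//; ring.
Qed.

Lemma rderive_cvg f l : piecewise_affine f -> 0 < l ->
  cvg ((f x - f l) / (x - l) @[x --> l^'+]).
Proof.
move=> fpa l0; have [s _ [y ly fE]] := piecewise_affine_right fpa l0.
apply/cvg_ex; exists s; apply: cvg_near_cst.
near=> x.
have lx : l < x by near: x; exact: nbhs_right_gt.
rewrite fE; last by rewrite ltW//=; near: x; exact: nbhs_right_le.
by rewrite addrC addKr mulfK// subr_eq0 gt_eqF.
Unshelve. all: by end_near. Qed.

Lemma lderive_cvg f l : piecewise_affine f -> 0 < l ->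
  cvg ((f x - f l) / (x - l) @[x --> l^'-]).
Proof.
move=> fpa l0; have [s _ [y ly fE]] := piecewise_affine_left fpa l0.
apply/cvg_ex; exists s; apply: cvg_near_cst.
near=> x.
have lx : x < l by near: x; exact: nbhs_left_lt.
rewrite fE; last by rewrite andbC ltW//=; near: x; exact: nbhs_left_ge.
by rewrite addrC addKr mulfK// subr_eq0 lt_eqF.
Unshelve. all: by end_near. Qed.

Lemma OrderB f g H : piecewise_affine f -> piecewise_affine g ->
  Order (f - g) H = Order f H - Order g H.
Proof.
move=> fpa gpa; have l0 := gen_gt0 H; rewrite /Order.
have E (l : R) : (fun x => ((f - g) x - (f - g) l) / (x - l)) =
    (fun x => (f x - f l) / (x - l)) - (fun x => (g x - g l) / (x - l)).
  by apply/funext => x; rewrite -[RHS]/(_ - _) -mulrBl;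
     congr (_ / _); rewrite -[LHS]/(f x - g x - (f l - g l)); ring.
have -> : rderive (f - g) (gen H) = rderive f (gen H) - rderive g (gen H).
  by rewrite {1}/rderive E; apply: limB; exact: rderive_cvg.
have -> : lderive (f - g) (gen H) = lderive f (gen H) - lderive g (gen H).
  by rewrite {1}/lderive E; apply: limB; exact: lderive_cvg.
ring.
Qed.

Lemma global_section0 : global_section 0.
Proof.
split=> [l _||//]; first exact: cst_continuous.
move=> a b _ _; exists [::] => x y _ _ _ _; exists 0 => [|t _].
  exact: (rpred0 Hp_pred).
by rewrite mul0r addr0.
Qed.

Lemma global_sectionB f g :
  global_section f -> global_section g -> global_section (f - g).
Proof.
move=> [fc fpa fp] [gc gpa gp]; split=> [l l0|a b a0 ab|l l0].
- by apply: continuousB; [exact: fc|exact: gc].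
- have [B BP] := fpa a b a0 ab; have [C CP] := gpa a b a0 ab.
  exists (B ++ C) => x y ax xy yb xyBC.
  have [t tB|s sHp fs] := BP x y ax xy yb.
    by apply: xyBC; rewrite mem_cat tB.
  have [t tC|r rHp gr] := CP x y ax xy yb.
    by apply: xyBC; rewrite mem_cat tC orbT.
  exists (s - r) => [|t xty]; first by rewrite rpredB.
  rewrite -[LHS]/(f t - g t) -[(f - g) x]/(f x - g x) fs// gr//.
  by ring.
- by rewrite -[LHS]/(f _ - g _) fp// gp.
Qed.

Definition principal_pred : {pred Div0} := fun D => `[< principal (val D) >].

Lemma principal_zmod_closed : zmod_closed principal_pred.
Proof.
split=> [|D E /asboolP[f fs Df] /asboolP[g gs Eg]]; apply/asboolP.
  exists 0; first exact: global_section0.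
  move=> H; have [_ pa _] := global_section0.
  by have := OrderB H pa pa; rewrite !subrr => ->.
exists (f - g); first exact: global_sectionB.
move=> H; rewrite OrderB; [|by case: fs|by case: gs].
by rewrite -Df -Eg.
Qed.

HB.instance Definition _ :=
  GRing.isZmodClosed.Build Div0 principal_pred principal_zmod_closed.

Definition Jac : Type := Quotient.quot principal_pred.
HB.instance Definition _ := Choice.on Jac.
HB.instance Definition _ := GRing.Zmodule.on Jac.
HB.instance Definition _ := ZmodQuotient.on Jac.

End ScalingSite.

Arguments Cp R p : clear implicits.

(* Z/(p-1)Z for p prime: the trivial group if p = 2, unlike 'Z_p.-1. *)
Definition Zpm1 (p : nat) : zmodType := 'I_p.-2.+1.

(* Main.v *)
Require Import Defs.
From HB Require Import structures.
From mathcomp Require Import all_boot all_order all_algebra ring_quotient ring lra.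
From mathcomp Require Import all_classical all_reals all_analysis.
Import Order.TTheory GRing.Theory Num.Theory numFieldNormedType.Exports.

Set Implicit Arguments.
Unset Strict Implicit.
Unset Printing Implicit Defensive.

Local Open Scope classical_set_scope.
Local Open Scope ring_scope.
Local Open Scope quotient_scope.

(** Every subgroup in C_p is t Z[1/p] for exactly one t in [1, p[, so a divisor
D is a finitely supported family of coefficients h(t) = D(t Z[1/p]) / t in
Z[1/p] on the fundamental domain [1, p[; its degree is the sum of the t h(t),
and chi D is the class of the sum of the h(t) ([deg_coord], [chi_coord]).

Principal divisors.  For a section f, the coefficient h(t) is the jump of the
slope of f at t.  Hence the sum of the h(t) telescopes, and the sum of the
t h(t) does so after a summation by parts: over the open interval ]1, p[ they
give f'^-(p) - f'^+(1) and p f'^-(p) - f'^+(1) - (f(p) - f(1))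
([slope_jump_sums]).  The jump at 1 is controlled by differentiating
f(p l) = f(l), which gives f'^-(1) = p f'^-(p).  Altogether the degree is
f(1) - f(p) = 0, and the sum of the jumps is (1 - p) f'^-(p), which lies in
(p - 1) Z[1/p] ([principal_deg_chi]).

Injectivity.  Conversely, let the degree be 0 and let the h(t) add up to
(p - 1) s with s in Z[1/p].  On [1, p] take the function that vanishes at 1 and
has jumps h(t) and slope c before any jump.  Extended by f(p l) = f(l), it has slope
p (c + (p - 1) s) on the left of 1, so there is no unwanted jump at 1 exactly
when c = - p s.  With this c its value at p is minus the degree, so the
extension is continuous ([theta], [principal_of_deg_chi]).

Surjectivity.  The real number 2 b can be placed in Z[1/p] or, as 2 times b, in
2 Z[1/p]; the difference of these two one-point divisors has degree 0 and
chi equal to the class of 2 b - b = b ([chi_deg0_surj]).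

Finally a / p^k |-> a mod (p - 1) identifies Z[1/p] / (p - 1) with Z / (p - 1),
because p = 1 mod (p - 1) ([residue_class]). *)

(** * Subgroups of R and the fundamental domain [1, p[ *)

Section FundamentalDomain.
Variables (R : realType) (p : nat).
Hypothesis p_prime : prime p.

Lemma natp_gt1 : 1 < p%:R :> R.
Proof. by rewrite ltr1n prime_gt1. Qed.

Lemma natp_gt0 : 0 < p%:R :> R.
Proof. exact: lt_trans ltr01 natp_gt1. Qed.

Lemma natp_neq0 : p%:R != 0 :> R.
Proof. by rewrite gt_eqF ?natp_gt0. Qed.

Lemma expz_natp_gt0 (k : int) : 0 < p%:R ^ k :> R.
Proof. exact: exprz_gt0 natp_gt0. Qed.

Lemma Hp_mul_expz (x : R) (k : int) :
  x \in Hp_pred p -> p%:R ^ k * x \in Hp_pred p.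
Proof.
case: k => n xHp.
  by rewrite -exprnP -natrX mulr_natl rpredMn.
have /Hp_predP[a [k ->]] := xHp; apply/Hp_predP; exists a, (k + n.+1)%N.
by rewrite NegzE -exprnN exprD invfM mulrCA (mulrC _^-1).
Qed.

Lemma scaleHp_expz (l : R) (k : int) :
  scaleHp p (l * p%:R ^ k) = scaleHp p l.
Proof.
apply/seteqP; split=> _ [x xHp <-].
  by exists (p%:R ^ k * x); [exact: Hp_mul_expz|rewrite mulrA].
exists (p%:R ^ (- k) * x); first exact: Hp_mul_expz.
by rewrite mulrA -(mulrA l) -expfzDr ?natp_neq0// subrr expr0z mulr1.
Qed.

Lemma scaleHp_refl (l : R) : scaleHp p l l.
Proof. by exists 1; [exact: Hp_one_subproof|rewrite mulr1]. Qed.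

(** The ratio of two positive generators is a positive unit of Z[1/p]: writing
it and its inverse as a / p^i and b / p^j gives a b = p^(i + j), and p is prime,
so a is a power of p. *)
Lemma scaleHp_eq (l m : R) : 0 < l -> 0 < m -> scaleHp p l = scaleHp p m ->
  exists k : int, l = m * p%:R ^ k.
Proof.
move=> l0 m0 lm.
have [_ /Hp_predP[a [i ->]] aE] : scaleHp p m l by rewrite -lm; exact: scaleHp_refl.
have [_ /Hp_predP[b [j ->]] bE] : scaleHp p l m by rewrite lm; exact: scaleHp_refl.
have pn0 n : p%:R ^+ n != 0 :> R by rewrite expf_neq0// natp_neq0.
have ab : a * b = (p ^ (i + j))%N.
  apply/eqP; rewrite -(eqr_int R) intrM -pmulrn natrX; apply/eqP.
  apply: (mulfI (lt0r_neq0 m0)).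
  rewrite -[in RHS]bE -[in RHS]aE exprD.
  by field; rewrite !pn0.
have a0 : 0 < a.
  rewrite -(ltr0z R) -(pmulr_rgt0 _ m0) -(@pmulr_lgt0 _ (p%:R ^+ i)^-1).
    by rewrite -mulrA aE.
  by rewrite invr_gt0 exprn_gt0// natp_gt0.
have /(dvdn_pfactor _ _ p_prime)[e _ ae] : (`|a| %| p ^ (i + j))%N.
  by apply/dvdnP; exists `|b|%N; rewrite mulnC -abszM ab.
exists (e%:Z - i%:Z); rewrite expfzDr ?natp_neq0// -exprnN -exprnP -aE.
by rewrite -(natrX _ p e) -ae natr_absz gtr0_norm.
Qed.

(** The representative in [1, p[ of the class of [l] modulo powers of p; the
default value 1 keeps it in [1, p[ for every real [l]. *)
Definition fund (l : R) : R :=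
  xget 1 [set t : R | 1 <= t < p%:R /\ exists k : int, l = t * p%:R ^ k].

Lemma fund_exists (l : R) : 0 < l ->
  exists t : R, 1 <= t < p%:R /\ exists k : int, l = t * p%:R ^ k.
Proof.
move=> l0; have lnp : 0 < ln p%:R :> R by rewrite ln_gt0// natp_gt1.
(* k is the integer part of the base p logarithm: p^k <= l < p^(k + 1) *)
pose k := Num.floor (ln l / ln p%:R); have /andP[kl lk] := floor_itv (ln l / ln p%:R).
have pk (n : int) : p%:R ^ n = expR (n%:~R * ln p%:R) :> R.
  by rewrite -powR_intmul ?ler0n// /powR (negPf natp_neq0).
exists (l / p%:R ^ k); split; last first.
  by exists k; rewrite divfK// gt_eqF// expz_natp_gt0.
rewrite ler_pdivlMr ?expz_natp_gt0// mul1r ltr_pdivrMr ?expz_natp_gt0//.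
rewrite -[X in X * _]expr1z -expfzDr ?natp_neq0// addrC !pk.
by rewrite -{1 2}(lnK l0) ler_expR ltr_expR -ler_pdivlMr// -ltr_pdivrMr// kl.
Qed.

Lemma fund_itv (l : R) : 1 <= fund l < p%:R.
Proof.
rewrite /fund; case: xgetP => [t _ []//|_].
by rewrite lexx natp_gt1.
Qed.

Lemma fund_gt0 (l : R) : 0 < fund l.
Proof. by have /andP[+ _] := fund_itv l; exact: lt_le_trans. Qed.

Lemma fundP (l : R) : 0 < l -> exists k : int, l = fund l * p%:R ^ k.
Proof.
by move=> /fund_exists l0; rewrite /fund; have [] := xgetPex 1 l0.
Qed.

Lemma fund_unique (t u : R) (k : int) : 1 <= t -> t < p%:R -> 1 <= u < p%:R ->
  t = u * p%:R ^ k -> t = u.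
Proof.
move=> t1 tp /andP[u1 up] tu; have u0 := lt_le_trans ltr01 u1.
have [k0|k0|k0] := ltgtP k 0.
- have : u * p%:R ^ k < 1.
    apply: (@le_lt_trans _ _ (u * p%:R ^ (-1))).
      rewrite (ler_pM2l u0) (ler_eXz2l natp_gt1).
      by rewrite -ltzD1 addNr.
    by rewrite -[p%:R ^ _]/(p%:R^-1) ltr_pdivrMr ?mul1r// natp_gt0.
  by rewrite -tu ltNge t1.
- have : p%:R <= u * p%:R ^ k.
    rewrite -[leLHS]mul1r; apply: ler_pM => //.
    by rewrite -[leLHS]expr1z ler_eXz2l ?natp_gt1// -gtz0_ge1.
  by rewrite -tu leNgt tp.
- by rewrite tu k0 expr0z mulr1.
Qed.

Lemma fundE (t : R) (k : int) : 1 <= t < p%:R -> fund (t * p%:R ^ k) = t.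
Proof.
move=> t1p; have t0 : 0 < t by case/andP: t1p => t1 _; exact: lt_le_trans t1.
have [|j tj] := @fundP (t * p%:R ^ k); first by rewrite mulr_gt0 ?expz_natp_gt0.
have /andP[f1 fp] := fund_itv (t * p%:R ^ k).
apply: (@fund_unique _ _ (k - j)) => //.
apply: (mulIf (lt0r_neq0 (expz_natp_gt0 j))).
by rewrite -tj -mulrA -expfzDr ?natp_neq0// subrK.
Qed.

Lemma fund_id (t : R) : 1 <= t < p%:R -> fund t = t.
Proof. by move=> /(fundE 0); rewrite expr0z mulr1. Qed.

Lemma fundMp (l : R) : 0 < l -> fund (p%:R * l) = fund l.
Proof.
move=> /fundP[k {1}->]; rewrite mulrCA -{1}[p%:R]expr1z -expfzDr ?natp_neq0//.
by rewrite fundE ?fund_itv.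
Qed.

Definition scale_val (l : R) (x : Hp R p) : R := l * val x.

Lemma scale_val_is_zmod_morphism (l : R) : zmod_morphism (scale_val l).
Proof. by move=> x y; rewrite /scale_val raddfB mulrBr. Qed.

HB.instance Definition _ (l : R) := GRing.isZmodMorphism.Build (Hp R p) R
  (scale_val l) (scale_val_is_zmod_morphism l).

Lemma scaleHp_Cp (l : R) : 0 < l -> Cp R p (scaleHp p l).
Proof.
move=> l0; split.
- by exists 0; rewrite ?mulr0//; exact: (rpred0 (Hp_pred p)).
- move=> _ _ [x xHp <-] [y yHp <-]; exists (x - y); last by rewrite mulrBr.
  exact: rpredB.
exists (scale_val l); split.
- by move=> x _; exists (val x) => //; exact: valP.
- by move=> x y _ _ /(mulfI (lt0r_neq0 l0)) /val_inj.
- by move=> _ [x xHp <-]; exists (exist _ x xHp).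
Qed.

Lemma Cp_point_subproof (t : R) : scaleHp p (fund t) \in Cp R p.
Proof. exact/mem_set/scaleHp_Cp/fund_gt0. Qed.

(** Going through [fund p t] yields a generator that is positive for every real
[t], and leaves the subgroup unchanged when [t] is positive. *)
Definition Cp_point (t : R) : Cp R p :=
  exist _ (scaleHp p (fund t)) (Cp_point_subproof t).

Definition rep (H : Cp R p) : R := fund (gen H).

Lemma rep_itv (H : Cp R p) : 1 <= rep H < p%:R.
Proof. exact: fund_itv. Qed.

Lemma rep_gt0 (H : Cp R p) : 0 < rep H.
Proof. exact: fund_gt0. Qed.

Lemma gen_rep (H : Cp R p) : exists k : int, gen H = rep H * p%:R ^ k.
Proof. exact/fundP/gen_gt0. Qed.

Lemma rep_scaleHp (H : Cp R p) : val H = scaleHp p (rep H).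
Proof. by rewrite gen_scaleHp; have [k ->] := gen_rep H; rewrite scaleHp_expz. Qed.

Lemma repK : cancel rep Cp_point.
Proof.
by move=> H; apply: val_inj; rewrite [RHS]rep_scaleHp /= fund_id// rep_itv.
Qed.

Lemma Cp_point_rep (t : R) : rep (Cp_point t) = fund t.
Proof.
have /= := rep_scaleHp (Cp_point t).
move=> /scaleHp_eq -/(_ (fund_gt0 _) (rep_gt0 _))[k].
have /andP[f1 fp] := fund_itv t.
by move=> /fund_unique ->//; exact: rep_itv.
Qed.

Lemma Cp_pointK (t : R) : 1 <= t < p%:R -> rep (Cp_point t) = t.
Proof. by rewrite Cp_point_rep; exact: fund_id. Qed.

Lemma rep_mem (H : Cp R p) (h : R) : val H h -> h / rep H \in Hp_pred p.
Proof.
rewrite rep_scaleHp => -[x xHp <-].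
by rewrite mulrAC mulfV ?mul1r// gt_eqF// rep_gt0.
Qed.

End FundamentalDomain.

(** * Degree and chi in coordinates on [1, p[ *)

Section Classes.
Variables (R : realType) (p : nat).
Hypothesis p_prime : prime p.

(** Class modulo (p - 1) of an element of Z[1/p], extended by 0 to all reals so
that it can be applied under sums without carrying membership proofs. *)
Definition cls (x : R) : HpQ R p := \pi_(HpQ R p) (insubd (0 : Hp R p) x).

Lemma cls_val (x : Hp R p) : cls (val x) = \pi_(HpQ R p) x.
Proof. by rewrite /cls valKd. Qed.

Lemma cls0 : cls 0 = 0.
Proof. by rewrite -[0 : R]/(val (0 : Hp R p)) cls_val raddf0. Qed.

Lemma clsB (x y : R) : x \in Hp_pred p -> y \in Hp_pred p ->
  cls (x - y) = cls x - cls y.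
Proof.
move=> xHp yHp; rewrite -[x]/(val (exist _ x xHp : Hp R p)).
by rewrite -[y]/(val (exist _ y yHp : Hp R p)) -raddfB !cls_val raddfB.
Qed.

Lemma clsD (x y : R) : x \in Hp_pred p -> y \in Hp_pred p ->
  cls (x + y) = cls x + cls y.
Proof.
move=> xHp yHp; rewrite -[x]/(val (exist _ x xHp : Hp R p)).
by rewrite -[y]/(val (exist _ y yHp : Hp R p)) -raddfD !cls_val raddfD.
Qed.

Lemma cls_sum (I : eqType) (r : seq I) (F : I -> R) :
  (forall i, i \in r -> F i \in Hp_pred p) ->
  cls (\sum_(i <- r) F i) = \sum_(i <- r) cls (F i).
Proof.
elim: r => [|i r IH] FHp; first by rewrite !big_nil cls0.
have FHr j : j \in r -> F j \in Hp_pred p by move=> jr; rewrite FHp// inE jr orbT.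
rewrite !big_cons clsD ?IH ?FHp ?mem_head//.
by rewrite big_seq rpred_sum.
Qed.

(** This invariance is why [chi] depends on no choice of generators: p x - x is
the multiple (p - 1) x. *)
Lemma cls_mulp (x : R) : x \in Hp_pred p -> cls (p%:R * x) = cls x.
Proof.
move=> xHp; rewrite mulr_natl -[x]/(val (exist _ x xHp : Hp R p)).
rewrite -raddfMn !cls_val; apply/eqP; rewrite -Quotient.idealrBE.
apply/asboolP; exists (exist _ x xHp).
by rewrite -subn1 mulrnBr ?prime_gt0.
Qed.

Lemma cls_expz (x : R) (k : int) : x \in Hp_pred p -> cls (p%:R ^ k * x) = cls x.
Proof.
have natn n y : y \in Hp_pred p -> cls (p%:R ^+ n * y) = cls y.
  elim: n => [|n IH] yHp; first by rewrite mul1r.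
  by rewrite exprS -mulrA cls_mulp ?IH//; exact: (Hp_mul_expz n%:Z yHp).
case: k => n xHp; first exact: natn.
rewrite -(natn n.+1) ?Hp_mul_expz//; congr cls.
by rewrite NegzE -exprnN mulrA mulfV ?mul1r// expf_neq0// natp_neq0.
Qed.

Lemma chi_atE (H : Cp R p) (h : R) (hH : val H h) : chi_at hH = cls (h / rep H).
Proof.
have [k gE] := gen_rep p_prime H.
rewrite /chi_at -cls_val/= -(cls_expz k (gen_inv_mem hH)) gE; congr cls.
by field; rewrite !gt_eqF ?rep_gt0 ?expz_natp_gt0.
Qed.

Lemma deg_seq (r : seq (Cp R p)) (D : Div R p) : uniq r ->
  (forall H, H \notin r -> val D H = 0) -> deg D = \sum_(H <- r) val D H.
Proof.
move=> ur Dr; rewrite /deg (fsbigE r)//=; last by move=> H _ /Dr.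
by apply: eq_bigl => H; rewrite in_setT.
Qed.

Lemma chi_seq (r : seq (Cp R p)) (D : Div R p) : uniq r ->
  (forall H, H \notin r -> val D H = 0) ->
  chi D = \sum_(H <- r) cls (val D H / rep H).
Proof.
move=> ur Dr; rewrite /chi.
under eq_fsbigr do rewrite chi_atE.
rewrite (fsbigE r)//=; last by move=> H _ /Dr ->; rewrite mul0r cls0.
by apply: eq_bigl => H; rewrite in_setT.
Qed.

Definition supp (D : Div R p) : seq (Cp R p) :=
  finmap.enum_fset (fset_set [set H | val D H != 0]).

Lemma supp_uniq (D : Div R p) : uniq (supp D).
Proof. exact: finmap.fset_uniq. Qed.

Lemma notin_supp (D : Div R p) (H : Cp R p) : H \notin supp D -> val D H = 0.
Proof.
rewrite /supp in_fset_set; last exact: div_finite.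
by rewrite notin_setE => /negP; rewrite negbK => /eqP.
Qed.

Lemma chi_is_zmod_morphism : zmod_morphism (@chi R p).
Proof.
move=> D E; pose r := undup (supp D ++ supp E).
have rP H : H \notin r -> val D H = 0 /\ val E H = 0.
  by rewrite mem_undup mem_cat negb_or => /andP[/notin_supp -> /notin_supp ->].
have ur : uniq r := undup_uniq _.
rewrite !(chi_seq ur)//; [|by move=> H /rP[]..|]; last first.
  by move=> H /rP[D0 E0]; rewrite raddfB /= -[LHS]/(val D H - val E H) D0 E0 subrr.
rewrite -sumrB; apply: eq_bigr => H _.
rewrite raddfB /= -[X in X / _]/(val D H - val E H) mulrBl clsB// rep_mem//.
  exact: div_mem.
exact: div_mem.
Qed.

Lemma map_Cp_point_uniq (xs : seq R) : uniq xs ->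
  (forall x, x \in xs -> 1 <= x < p%:R) -> uniq (map (Cp_point p_prime) xs).
Proof.
move=> uxs xs1p; rewrite map_inj_in_uniq// => x y xxs yxs.
by move=> /(congr1 (@rep R p)); rewrite !Cp_pointK ?xs1p.
Qed.

Lemma mem_map_Cp_point (xs : seq R) (H : Cp R p) :
  rep H \in xs -> H \in map (Cp_point p_prime) xs.
Proof. by move=> Hxs; apply/mapP; exists (rep H) => //; rewrite repK. Qed.

Lemma deg_coord (xs : seq R) (D : Div R p) : uniq xs ->
  (forall x, x \in xs -> 1 <= x < p%:R) ->
  (forall H, rep H \notin xs -> val D H = 0) ->
  deg D = \sum_(x <- xs) val D (Cp_point p_prime x).
Proof.
move=> uxs xs1p Dxs; rewrite (deg_seq (map_Cp_point_uniq uxs xs1p)) ?big_map//.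
by move=> H Hxs; apply: Dxs; apply: contra Hxs; exact: mem_map_Cp_point.
Qed.

Lemma chi_coord (xs : seq R) (D : Div R p) : uniq xs ->
  (forall x, x \in xs -> 1 <= x < p%:R) ->
  (forall H, rep H \notin xs -> val D H = 0) ->
  chi D = \sum_(x <- xs) cls (val D (Cp_point p_prime x) / x).
Proof.
move=> uxs xs1p Dxs; rewrite (chi_seq (map_Cp_point_uniq uxs xs1p)) ?big_map.
  by apply: eq_big_seq => x xxs; rewrite Cp_pointK ?xs1p.
by move=> H Hxs; apply: Dxs; apply: contra Hxs; exact: mem_map_Cp_point.
Qed.

End Classes.

(** * One-sided slopes of piecewise affine functions *)

Section Slopes.
Variables (R : realType) (p : nat).
Implicit Types f : R -> R.

Definition slope_jump f (x : R) : R := rderive f x - lderive f x.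

Lemma rderive_affine f (l y s : R) : l < y ->
  (forall t, l <= t <= y -> f t = f l + s * (t - l)) -> rderive f l = s.
Proof.
move=> ly fE; apply: cvg_lim => //; apply: cvg_near_cst; near=> x.
have lx : l < x by near: x; exact: nbhs_right_gt.
rewrite fE; last by rewrite ltW//=; near: x; exact: nbhs_right_le.
by rewrite addrC addKr mulfK// subr_eq0 gt_eqF.
Unshelve. all: by end_near. Qed.

Lemma lderive_affine f (l y s : R) : y < l ->
  (forall t, y <= t <= l -> f t = f l + s * (t - l)) -> lderive f l = s.
Proof.
move=> yl fE; apply: cvg_lim => //; apply: cvg_near_cst; near=> x.
have xl : x < l by near: x; exact: nbhs_left_lt.
rewrite fE; last by rewrite andbC ltW//=; near: x; exact: nbhs_left_ge.
by rewrite addrC addKr mulfK// subr_eq0 lt_eqF.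
Unshelve. all: by end_near. Qed.

Lemma affine_derive f (x y s : R) : x < y ->
    (forall t, x <= t <= y -> f t = f x + s * (t - x)) ->
  [/\ rderive f x = s, lderive f y = s & f y - f x = s * (y - x)].
Proof.
move=> xy fE; have fy : f y = f x + s * (y - x) by rewrite fE// lexx ltW.
split; [exact: rderive_affine fE|apply: (lderive_affine xy)|rewrite fy; ring].
by move=> t /fE ->; rewrite fy; ring.
Qed.

Lemma rderive_mem f (l : R) : piecewise_affine p f -> 0 < l ->
  rderive f l \in Hp_pred p.
Proof.
move=> fpa l0; have [s sHp [y ly fE]] := piecewise_affine_right fpa l0.
by rewrite (rderive_affine ly fE).
Qed.

Lemma lderive_mem f (l : R) : piecewise_affine p f -> 0 < l ->
  lderive f l \in Hp_pred p.
Proof.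
move=> fpa l0; have [s sHp [y ly fE]] := piecewise_affine_left fpa l0.
by rewrite (lderive_affine ly fE).
Qed.

Lemma slope_jump_mem f (l : R) : piecewise_affine p f -> 0 < l ->
  slope_jump f l \in Hp_pred p.
Proof. by move=> fpa l0; rewrite rpredB ?rderive_mem ?lderive_mem. Qed.

(** The clause of [piecewise_affine] for one interval, with the break points
made explicit so that they can be sorted and summed over. *)
Definition affine_off (B : seq R) f (a b : R) :=
  forall x y : R, a <= x -> x < y -> y <= b ->
    (forall t, t \in B -> ~~ (x < t < y)) ->
  exists2 s : R, s \in Hp_pred p &
    forall t, x <= t <= y -> f t = f x + s * (t - x).

Lemma slope_jump_off (B : seq R) f (a b x : R) : affine_off B f a b ->
  a < x -> x < b -> x \notin B -> slope_jump f x = 0.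
Proof.
move=> fB ax xb xNB.
have [y [xy yb yB]] := no_break_right B xb.
have [z [zx az zB]] := no_break_left B ax.
have [t tB|s _ fE] := fB z y az (lt_trans zx xy) yb.
  have [tx|xt|tx] := ltgtP t x; last by rewrite -tx tB in xNB.
    by have := zB t tB; rewrite tx andbT => /negPf ->.
  by have := yB t tB; rewrite xt /= => /negPf ->; rewrite andbF.
have fx : f x = f z + s * (x - z) by rewrite fE// !ltW.
rewrite /slope_jump (@rderive_affine f x y s)// ?(@lderive_affine f x z s) ?subrr//.
  by move=> t /andP[zt tx]; rewrite fE ?fx ?zt ?(le_trans tx (ltW xy))//; ring.
by move=> t /andP[xt ty]; rewrite fE ?fx ?ty ?(le_trans (ltW zx) xt)//; ring.
Qed.

(** Induction on the break points, from the left.  On the first piece [a, c] the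
slope is constant, equal to f'^+(a) = f'^-(c); so the jump at [c] turns f'^+(c)
into f'^+(a), and in the weighted sum the discrepancy (c - a) f'^+(a) is
f(c) - f(a). *)
Lemma slope_jump_sums (B : seq R) f (a b : R) : affine_off B f a b ->
    path <%R a (rcons B b) ->
  \sum_(x <- B) slope_jump f x = lderive f b - rderive f a /\
  \sum_(x <- B) x * slope_jump f x =
    b * lderive f b - a * rderive f a - (f b - f a).
Proof.
elim: B a => [|c B IH] a /= fB.
  rewrite andbT => ab; rewrite !big_nil.
  have [//|s _ fE] := fB a b (lexx _) ab (lexx _).
  have [-> -> ->] := affine_derive ab fE; split; ring.
move=> /andP[ac cB]; have cmin := order_path_min lt_trans cB.
have cb : c < b by move/allP: cmin; apply; rewrite mem_rcons mem_head.
have cltB t : t \in B -> c < t.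
  by move=> tB; move/allP: cmin; apply; rewrite mem_rcons inE tB orbT.
have [|sum1 sumx] := IH c _ cB.
  move=> x y cx xy yb xyB; apply: fB => // [|t].
    exact: le_trans (ltW ac) cx.
  by rewrite inE => /predU1P[->|/xyB//]; rewrite ltNge cx.
have [t|s _ fE] := fB a c (lexx _) ac (ltW cb).
  rewrite inE => /predU1P[->|/cltB ct]; first by rewrite ltxx andbF.
  by rewrite (ltNge t) ltW// andbF.
have [ra lc fca] := affine_derive ac fE.
have fc : f c = f a + s * (c - a) by rewrite -fca; ring.
rewrite !big_cons sum1 sumx /slope_jump ra lc fc; split; ring.
Qed.

End Slopes.

Lemma piecewise_affine_continuous (R : realType) (p : nat) (f : R -> R) (l : R) :
  piecewise_affine p f -> 0 < l -> {for l, continuous f}.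
Proof.
move=> fpa l0.
have lin (F : set_system R) (s : R) : Filter F -> F --> l ->
    f l + s * (x - l) @[x --> F] --> f l.
  move=> FF Fl; rewrite -[X in _ --> X]addr0 -[X in _ + X](mulr0 s) -(subrr l).
  apply: cvgD; first exact: cvg_cst.
  by apply: cvgM; [exact: cvg_cst|apply: cvgB => //; exact: cvg_cst].
apply/left_right_continuousP; split.
- have [s _ [y yl fE]] := piecewise_affine_left fpa l0.
  apply: cvg_trans (lin _ s _ (cvg_at_left_filter cvg_id)).
  apply: near_eq_cvg; near=> x; rewrite (fE x)//.
  by apply/andP; split; [near: x; exact: nbhs_left_ge|near: x; exact: nbhs_left_le].
- have [s _ [y ly fE]] := piecewise_affine_right fpa l0.
  apply: cvg_trans (lin _ s _ (cvg_at_right_filter cvg_id)).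
  apply: near_eq_cvg; near=> x; rewrite (fE x)//.
  by apply/andP; split; [near: x; exact: nbhs_right_ge|near: x; exact: nbhs_right_le].
Unshelve. all: by end_near. Qed.

(** * Divisors of global sections have degree 0 and chi 0 *)

Section GlobalSections.
Variables (R : realType) (p : nat).
Hypothesis p_prime : prime p.
Variable f : R -> R.
Hypothesis f_section : global_section p f.

Let f_affine : piecewise_affine p f. Proof. by case: f_section. Qed.

Let f_period (l : R) : 0 < l -> f (p%:R * l) = f l.
Proof. by case: f_section => _ _; exact. Qed.

Lemma rderive_period (l : R) : 0 < l -> rderive f (p%:R * l) = rderive f l / p%:R.
Proof.
move=> l0; have [s _ [y ly fE]] := piecewise_affine_right f_affine l0.
have p0 := natp_gt0 R p_prime.
rewrite (rderive_affine ly fE); apply: (@rderive_affine _ _ _ (p%:R * y)).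
  by rewrite ltr_pM2l.
move=> t /andP[lt ty].
have tp : t = p%:R * (t / p%:R) by rewrite mulrC divfK// gt_eqF.
rewrite tp !ler_pM2l// in lt ty.
rewrite {1}tp !f_period ?(lt_le_trans l0)// fE ?lt//.
by field; rewrite gt_eqF.
Qed.

Lemma lderive_period (l : R) : 0 < l -> lderive f (p%:R * l) = lderive f l / p%:R.
Proof.
move=> l0; have [s _ [y yl fE]] := piecewise_affine_left f_affine l0.
have p0 := natp_gt0 R p_prime.
rewrite (lderive_affine yl fE).
have l20 : 0 < l / 2 by rewrite divr_gt0.
apply: (@lderive_affine _ _ _ (p%:R * Num.max y (l / 2))).
  by rewrite ltr_pM2l// gt_max yl/=; lra.
move=> t /andP[lt ty].
have tp : t = p%:R * (t / p%:R) by rewrite mulrC divfK// gt_eqF.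
rewrite tp !ler_pM2l// ge_max in lt ty; have /andP[yt l2t] := lt.
rewrite {1}tp !f_period ?(lt_le_trans l20 l2t)// fE ?yt//.
by field; rewrite gt_eqF.
Qed.

(** Both one-sided slopes are divided by p when the argument is multiplied by
p, so the weighted jump is constant on orbits; this is why the order of [f] at a
subgroup can be computed at its representative in [1, p[. *)
Lemma order_expz (l : R) (k : int) : 0 < l ->
  l * p%:R ^ k * slope_jump f (l * p%:R ^ k) = l * slope_jump f l.
Proof.
have p0 := natp_gt0 R p_prime.
have natn n (m : R) : 0 < m ->
    m * p%:R ^+ n * slope_jump f (m * p%:R ^+ n) = m * slope_jump f m.
  move=> m0; elim: n => [|n <-]; first by rewrite mulr1.
  rewrite exprSr mulrA [m * _ * p%:R]mulrC.
  rewrite /slope_jump rderive_period ?lderive_period ?mulr_gt0 ?exprn_gt0//.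
  by field; rewrite gt_eqF.
case: k => n l0; first exact: natn.
rewrite -[RHS](_ : l * p%:R ^ Negz n * p%:R ^+ n.+1 *
  slope_jump f (l * p%:R ^ Negz n * p%:R ^+ n.+1) = _).
  by rewrite natn// mulr_gt0// expz_natp_gt0.
by rewrite NegzE -exprnN divfK// expf_neq0// gt_eqF.
Qed.

Lemma Order_rep (H : Cp R p) : Order f H = rep H * slope_jump f (rep H).
Proof.
rewrite /Order -/(slope_jump f (gen H)); have [k ->] := gen_rep p_prime H.
by rewrite order_expz// rep_gt0.
Qed.

(** The break points in ]1, p[, together with 1 itself, which stands for both
ends of the period: its left slope is p times the left slope at p. *)
Lemma section_breaks : exists xs : seq R, [/\ uniq (1 :: xs),
    forall x, x \in 1 :: xs -> 1 <= x < p%:R,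
    forall H : Cp R p, rep H \notin 1 :: xs -> Order f H = 0,
    \sum_(x <- 1 :: xs) x * slope_jump f x = 0 &
    \sum_(x <- 1 :: xs) slope_jump f x = lderive f p%:R - p%:R * lderive f p%:R].
Proof.
have p1 := natp_gt1 R p_prime; have p0 := natp_gt0 R p_prime.
have [B fB] := f_affine ltr01 p1.
pose xs := sort <=%R (undup [seq x <- B | 1 < x < p%:R]).
have xsE x : (x \in xs) = (1 < x < p%:R) && (x \in B).
  by rewrite mem_sort mem_undup mem_filter.
have xs_lt : sorted <%R xs by rewrite sort_lt_sorted undup_uniq.
have fxs : affine_off p xs f 1 p%:R.
  move=> x y x1 xy yp xyxs; apply: fB => // t tB; apply/negP => /andP[xt ty].
  move: (xyxs t); rewrite xsE tB xt ty (le_lt_trans x1 xt) (lt_le_trans ty yp).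
  by move=> /(_ isT).
have path_xs : path <%R 1 (rcons xs p%:R).
  rewrite rcons_path; apply/andP; split.
    rewrite lt_path_sortedE xs_lt andbT; apply/allP => x.
    by rewrite xsE => /andP[/andP[]].
  have := mem_last 1 xs; rewrite inE => /predU1P[->//|].
  by rewrite xsE => /andP[/andP[]].
have [sum1 sumx] := slope_jump_sums fxs path_xs.
have f1 : f p%:R = f 1 by rewrite -[p%:R]mulr1 f_period.
have l1 : lderive f p%:R = lderive f 1 / p%:R.
  by rewrite -{1}[p%:R]mulr1 lderive_period.
exists xs; split.
- by rewrite /= sort_uniq undup_uniq xsE ltxx.
- move=> x; rewrite inE => /predU1P[->|]; first by rewrite lexx.
  by rewrite xsE => /andP[/andP[/ltW -> ->]].
- move=> H; rewrite inE negb_or => /andP[H1 Hxs].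
  have /andP[r1 rp] := rep_itv p_prime H.
  rewrite Order_rep (slope_jump_off fxs) ?mulr0//.
  by rewrite lt_neqAle eq_sym H1.
- by rewrite big_cons sumx l1 f1 /slope_jump; field; rewrite gt_eqF.
- by rewrite big_cons sum1 l1 /slope_jump; field; rewrite gt_eqF.
Qed.

Lemma Order_divisor : exists D : Div R p, forall H, val D H = Order f H.
Proof.
have [xs [_ _ Oxs _ _]] := section_breaks.
have Odiv : (fun H => Order f H) \in @divisor_pred R p.
  apply/asboolP; split=> [H|].
    rewrite /Order [X in X (_ * _)]gen_scaleHp.
    by exists (slope_jump f (gen H)) => //; exact: slope_jump_mem (gen_gt0 H).
  apply: (@sub_finite_set _ _ [set` map (Cp_point p_prime) (1 :: xs)]) => // H OH.
  apply: (mem_map_Cp_point p_prime (xs := 1 :: xs)).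
  by apply: contra_neqT OH => /Oxs.
by exists (exist (fun D => D \in @divisor_pred R p) _ Odiv).
Qed.

Lemma principal_deg_chi (D : Div R p) : (forall H, val D H = Order f H) ->
  deg D = 0 /\ chi D = 0.
Proof.
move=> DE; have [xs [uxs xs1p Oxs sumx sum1]] := section_breaks.
have Dxs H : rep H \notin 1 :: xs -> val D H = 0 by rewrite DE => /Oxs.
have DC x : x \in 1 :: xs -> val D (Cp_point p_prime x) = x * slope_jump f x.
  by move=> /xs1p x1p; rewrite DE Order_rep !Cp_pointK.
have x0 x : x \in 1 :: xs -> 0 < x.
  by move=> /xs1p/andP[x1 _]; exact: lt_le_trans x1.
rewrite (deg_coord p_prime uxs xs1p Dxs) (chi_coord p_prime uxs xs1p Dxs).
rewrite (eq_big_seq _ DC) sumx; split=> //.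
have -> : \sum_(x <- 1 :: xs) cls p (val D (Cp_point p_prime x) / x) =
          \sum_(x <- 1 :: xs) cls p (slope_jump f x).
  by apply: eq_big_seq => x xxs; rewrite DC// mulrAC mulfV ?mul1r// gt_eqF// x0.
rewrite -cls_sum; last by move=> x /x0; exact: slope_jump_mem.
have lHp := lderive_mem f_affine (natp_gt0 R p_prime).
rewrite sum1 clsB//; last by rewrite mulr_natl rpredMn.
by rewrite (cls_mulp p_prime)// subrr.
Qed.

End GlobalSections.

(** * A section with prescribed slope jumps *)

Section SectionOfDivisor.
Variables (R : realType) (p : nat).
Hypothesis p_prime : prime p.
Variables (xs : seq R) (h : R -> R) (s : R).
Hypotheses (xs_uniq : uniq xs) (xs_itv : forall x, x \in xs -> 1 <= x < p%:R).
Hypotheses (h_mem : forall x, x \in xs -> h x \in Hp_pred p)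
  (s_mem : s \in Hp_pred p).
Hypotheses (sum_h : \sum_(x <- xs) h x = (p%:R - 1) * s)
  (sum_xh : \sum_(x <- xs) x * h x = 0).

Let p0 : 0 < p%:R :> R := natp_gt0 R p_prime.
Let p1 : 1 < p%:R :> R := natp_gt1 R p_prime.
Let pz0 (k : int) : 0 < p%:R ^ k :> R := expz_natp_gt0 R p_prime k.

(** The function on [1, p] with value 0 at 1, slope jump [h x] at each [x] in
[xs], and slope - p s before any jump; 1 itself may belong to [xs]. *)
Definition primitive (t : R) : R :=
  - (p%:R * s) * (t - 1) + \sum_(x <- xs) h x * Num.max 0 (t - x).

Definition slope_upto (v : R) : R :=
  - (p%:R * s) + \sum_(x <- xs | x < v) h x.

Lemma slope_upto_mem (v : R) : slope_upto v \in Hp_pred p.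
Proof.
rewrite rpredD// ?rpredN ?mulr_natl ?rpredMn//.
by rewrite big_seq_cond rpred_sum// => x /andP[/h_mem].
Qed.

Lemma primitive_affine (u v t : R) : (forall x, x \in xs -> ~~ (u < x < v)) ->
  u <= t <= v -> primitive t = primitive u + slope_upto v * (t - u).
Proof.
move=> xsuv /andP[ut tv]; rewrite /primitive /slope_upto.
have -> : \sum_(x <- xs) h x * Num.max 0 (t - x) =
    \sum_(x <- xs) h x * Num.max 0 (u - x) + (\sum_(x <- xs | x < v) h x) * (t - u).
  rewrite mulr_suml [X in _ + X]big_mkcond -big_split; apply: eq_big_seq => x xxs /=.
  have := xsuv x xxs; case: (ltP x v) => [xv|vx]; last first.
    move=> _; rewrite addr0 !max_l// subr_le0.
      exact: le_trans (le_trans ut tv) vx.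
    exact: le_trans tv vx.
  rewrite andbT -leNgt => xu; rewrite !max_r ?subr_ge0//.
    by ring.
  exact: le_trans xu ut.
by ring.
Qed.

Lemma primitive1 : primitive 1 = 0.
Proof.
rewrite /primitive subrr mulr0 add0r big_seq big1// => x /xs_itv/andP[x1 _].
by rewrite max_l ?mulr0// subr_le0.
Qed.

(** This is where degree 0 enters: together with [primitive1] it makes the
periodic extension continuous at powers of p. *)
Lemma primitivep : primitive p%:R = 0.
Proof.
have -> : primitive p%:R = - (p%:R * s) * (p%:R - 1) +
    (p%:R * \sum_(x <- xs) h x - \sum_(x <- xs) x * h x).
  rewrite /primitive mulr_sumr -sumrB; congr (_ + _).
  apply: eq_big_seq => x /xs_itv/andP[_ xp].
  by rewrite max_r ?subr_ge0 ?(ltW xp)//; ring.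
by rewrite sum_h sum_xh; ring.
Qed.

Definition theta (l : R) : R := primitive (fund p l).

(** The upper end [t = p] is included, so that a whole closed period is treated
as one piece. *)
Lemma thetaE (t : R) (k : int) : 1 <= t <= p%:R -> theta (t * p%:R ^ k) = primitive t.
Proof.
move=> /andP[t1]; rewrite le_eqVlt => /predU1P[->|tp]; last first.
  by rewrite /theta fundE// t1.
rewrite primitivep -primitive1 /theta -{1}[p%:R]expr1z -expfzDr ?gt_eqF//.
by rewrite -[p%:R ^ _]mul1r fundE// lexx.
Qed.

Lemma theta_affine (k : int) (x y t : R) : p%:R ^ k <= x -> y <= p%:R ^ (k + 1) ->
  (forall c, c \in xs -> ~~ (x < c * p%:R ^ k < y)) -> x <= t <= y ->
  theta t = theta x + slope_upto (y / p%:R ^ k) / p%:R ^ k * (t - x).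
Proof.
move=> kx yk xyxs /andP[xt ty].
have k0 := pz0 k; have kn0 : p%:R ^ k != 0 :> R by rewrite gt_eqF.
have theta_prim z : x <= z -> z <= y -> theta z = primitive (z / p%:R ^ k).
  move=> xz zy; rewrite -[in LHS](divfK kn0 z) thetaE//.
  rewrite ler_pdivlMr// mul1r (le_trans kx xz)/= ler_pdivrMr//.
  by rewrite -[X in X * _]expr1z -expfzDr ?gt_eqF// addrC (le_trans zy).
rewrite !theta_prim// ?(le_trans xt)//.
rewrite (@primitive_affine (x / p%:R ^ k) (y / p%:R ^ k)).
- by field.
- by move=> c /xyxs; rewrite ltr_pdivrMr// ltr_pdivlMr.
- by rewrite !ler_pM2r ?invr_gt0// xt.
Qed.

Lemma expz_bracket (l : R) : 0 < l ->
  exists k : int, p%:R ^ k <= l < p%:R ^ (k + 1).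
Proof.
move=> /(fundP p_prime)[k lE]; exists k; have /andP[l1 lp] := fund_itv p_prime l.
rewrite {1 2}lE expfzDr ?gt_eqF// mulrC expr1z.
by rewrite -{1}[p%:R ^ k]mulr1 ler_pM2l// l1/= ltr_pM2l.
Qed.

(** The break points in [a, b] are found among the translates c p^m of 1 and of
the points of [xs], for the finitely many periods m that meet [a, b]; keeping the
powers of p themselves as break points confines every piece to one period. *)
Lemma theta_piecewise_affine : piecewise_affine p theta.
Proof.
move=> a b a0 ab.
have [i /andP[ia _]] := expz_bracket a0.
have [j /andP[_ bj]] := expz_bracket (lt_trans a0 ab).
(* one period beyond the last one, to include its right end *)
pose B := [seq c * p%:R ^ (i + k%:Z) | k <- iota 0 `|j - i|.+2, c <- 1 :: xs].
exists B => x y ax xy yb xyB; have x0 := lt_le_trans a0 ax.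
have [k /andP[kx xk]] := expz_bracket x0.
have ik : i <= k.
  rewrite -ltzD1 -(ltr_eXz2l p1).
  exact: le_lt_trans ia (le_lt_trans ax xk).
have kj : k <= j.
  rewrite -ltzD1 -(ltr_eXz2l p1).
  exact: le_lt_trans kx (lt_trans (lt_le_trans xy yb) bj).
have inB c d : c \in 1 :: xs -> (0 <= d <= 1)%N -> c * p%:R ^ (k + d%:Z) \in B.
  move=> cxs /andP[_ d1]; apply/allpairsP; exists ((`|k - i| + d)%N, c).
  split=> //; last by rewrite [in RHS]PoszD gez0_abs ?subr_ge0// addrA [i + _]addrC subrK.
  rewrite mem_iota add0n /= -addn2 -addnS leq_add//.
  by rewrite -lez_nat !gez0_abs ?subr_ge0 ?(le_trans ik)// lerD2r.
exists (slope_upto (y / p%:R ^ k) / p%:R ^ k).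
  by rewrite mulrC invr_expz (Hp_mul_expz (- k)) ?slope_upto_mem.
move=> t; apply: theta_affine => //.
  have := xyB _ (inB 1 1%N (mem_head _ _) isT).
  by rewrite mul1r xk/= -leNgt.
move=> c cxs; have := xyB _ (inB c 0%N _ isT); rewrite addr0; apply.
by rewrite inE cxs orbT.
Qed.

Lemma theta_section : global_section p theta.
Proof.
split; last by move=> l l0; rewrite /theta fundMp.
  by move=> l; apply: piecewise_affine_continuous; exact: theta_piecewise_affine.
exact: theta_piecewise_affine.
Qed.

Lemma rderive_theta (l : R) : 1 <= l < p%:R ->
  rderive theta l = - (p%:R * s) + \sum_(x <- xs | x <= l) h x.
Proof.
move=> /andP[l1 lp]; have [y [ly yp yxs]] := no_break_right xs lp.
rewrite (@rderive_affine _ _ l y (slope_upto y))//.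
  rewrite /slope_upto; congr (_ + _); rewrite big_seq_cond [RHS]big_seq_cond.
  apply: eq_bigl => x; apply: andb_id2l => xxs.
  have := yxs x xxs; case: (leP x l) => [xl _|lx /=]; first exact: le_lt_trans xl ly.
  by move=> /negPf.
move=> t lty; have := @theta_affine 0 l y t.
by rewrite expr0z !divr1 add0r expr1z; apply=> // c; rewrite mulr1; exact: yxs.
Qed.

Lemma lderive_theta_gt1 (l : R) : 1 < l -> l <= p%:R ->
  lderive theta l = slope_upto l.
Proof.
move=> l1 lp; have [y [yl y1 yxs]] := no_break_left xs l1.
have aff t : y <= t <= l -> theta t = theta y + slope_upto l * (t - y).
  move=> ytl; have := @theta_affine 0 y l t.
  by rewrite expr0z !divr1 add0r expr1z; apply=> // c; rewrite mulr1; exact: yxs.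
by have [] := affine_derive yl aff.
Qed.

(** At [l = 1] the left slope is p times the left slope at p, that is,
p (- p s + (p - 1) s) = - p s: this requirement dictates the value - p s. *)
Lemma lderive_theta (l : R) : 1 <= l < p%:R -> lderive theta l = slope_upto l.
Proof.
move=> /andP[]; rewrite le_eqVlt => /predU1P[<- _|l1 lp]; last first.
  exact: lderive_theta_gt1 (ltW lp).
have := lderive_period p_prime theta_section ltr01.
rewrite mulr1 lderive_theta_gt1// => lE.
rewrite -[lderive _ _](divfK (lt0r_neq0 p0)) -lE /slope_upto.
have -> : \sum_(x <- xs | x < p%:R) h x = (p%:R - 1) * s.
  rewrite -sum_h big_mkcond; apply: eq_big_seq => x /xs_itv/andP[_ ->].
  by [].
have -> : \sum_(x <- xs | x < 1) h x = 0.
  by rewrite big_seq_cond big1// => x /andP[/xs_itv/andP[x1 _]]; rewrite ltNge x1.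
by ring.
Qed.

Lemma slope_jump_theta (l : R) : 1 <= l < p%:R ->
  slope_jump theta l = if l \in xs then h l else 0.
Proof.
move=> l1p; rewrite /slope_jump rderive_theta// lderive_theta// /slope_upto.
rewrite opprD addrACA subrr add0r.
have -> : \sum_(x <- xs | x <= l) h x =
    \sum_(x <- xs | x == l) h x + \sum_(x <- xs | x < l) h x.
  rewrite (bigID (fun x => x == l)) /=; congr (_ + _); apply: eq_bigl => x.
    by have [->|] := eqVneq x l; rewrite ?lexx ?andbF.
  by rewrite lt_neqAle andbC.
rewrite addrK; case: ifPn => [lxs|lNxs].
  by rewrite -big_filter filter_pred1_uniq// big_seq1.
by rewrite big_seq_cond big1// => x /andP[xxs /eqP xl]; rewrite -xl xxs in lNxs.
Qed.

End SectionOfDivisor.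

(** * Degree 0 and chi 0 imply principal *)

Section PrincipalCriterion.
Variables (R : realType) (p : nat).
Hypothesis p_prime : prime p.

Lemma cls_eq0 (x : R) : x \in Hp_pred p -> cls p x = 0 ->
  exists2 y, y \in Hp_pred p & x = (p%:R - 1) * y.
Proof.
move=> xHp; rewrite -[x]/(val (exist _ x xHp : Hp R p)) cls_val.
rewrite -(raddf0 (\pi_(HpQ R p))) => /eqP; rewrite -Quotient.idealrBE subr0.
move=> /asboolP[y ->]; exists (val y); first exact: valP.
have -> : p%:R - 1 = p.-1%:R :> R by rewrite -subn1 natrB ?prime_gt0.
by rewrite raddfMn mulr_natl.
Qed.

Lemma principal_of_deg_chi (D : Div R p) : deg D = 0 -> chi D = 0 -> principal D.
Proof.
pose xs := map (@rep R p) (supp D).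
have uxs : uniq xs.
  by rewrite map_inj_uniq ?supp_uniq//; exact: can_inj (repK p_prime).
have xs_itv x : x \in xs -> 1 <= x < p%:R.
  by move=> /mapP[H _ ->]; exact: rep_itv.
have Dxs H : rep H \notin xs -> val D H = 0.
  by rewrite mem_map; [exact: notin_supp|exact: can_inj (repK p_prime)].
pose h x := val D (Cp_point p_prime x) / x.
have h_mem x : x \in xs -> h x \in Hp_pred p.
  move=> /xs_itv x1p; rewrite /h -{2}(Cp_pointK p_prime x1p).
  by apply: rep_mem => //; exact: div_mem.
rewrite (deg_coord p_prime uxs xs_itv Dxs) (chi_coord p_prime uxs xs_itv Dxs).
move=> D0; rewrite -cls_sum// => /cls_eq0[|s s_mem sum_h].
  by rewrite big_seq rpred_sum.
have sum_xh : \sum_(x <- xs) x * h x = 0.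
  rewrite -[RHS]D0; apply: eq_big_seq => x /xs_itv/andP[x1 _].
  by rewrite mulrC divfK// gt_eqF// (lt_le_trans ltr01).
have th := theta_section p_prime xs_itv h_mem s_mem sum_h sum_xh.
exists (theta p xs h s) => // H.
rewrite (Order_rep p_prime th) (slope_jump_theta p_prime)// ?rep_itv//.
case: ifPn => [_|/Dxs ->]; last by rewrite mulr0.
by rewrite /h repK mulrC divfK// gt_eqF// rep_gt0.
Qed.

End PrincipalCriterion.

(** * The groups Z[1/p] / (p - 1) and Z / (p - 1) *)

(** First isomorphism theorem, for the quotients by which the groups of
classes are encoded. *)
Lemma first_isomorphism (V W : zmodType) (S : zmodClosed V) (g : {additive V -> W}) :
    (forall v, (v \in S) = (g v == 0)) -> (forall w, exists v, g v = w) ->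
  exists2 gbar : {additive (Quotient.quot S) -> W}, bijective gbar &
    forall v, gbar (\pi_(Quotient.quot S) v) = g v.
Proof.
move=> gker gsurj; pose gbar (q : Quotient.quot S) := g (repr q).
have gbarE v : gbar (\pi v) = g v.
  apply/eqP; rewrite -subr_eq0 -raddfB -gker Quotient.idealrBE reprK.
  exact/eqP.
have gbarB : zmod_morphism gbar.
  elim/quotP=> v _; elim/quotP=> w _.
  by rewrite -raddfB !gbarE raddfB.
pose gadd := GRing.isZmodMorphism.Build (Quotient.quot S) W gbar gbarB.
pose G : {additive (Quotient.quot S) -> W} := HB.pack gbar gadd.
exists G => //; have [inv invP] := choice gsurj.
exists (fun w => \pi_(Quotient.quot S) (inv w)) => [|w]; last by rewrite [LHS]gbarE invP.
elim/quotP=> v _; apply/eqP; rewrite -Quotient.idealrBE gker raddfB /=.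
by rewrite invP -[X in X - _]/(gbar _) gbarE subrr.
Qed.

Section Residue.
Variables (R : realType) (p : nat).
Hypothesis p_prime : prime p.

Let u : Zpm1 p := inZp 1.

Lemma Zpm1_mulrn n : u *+ n = inZp n.
Proof.
rewrite [u *+ n]Zp_mulrn; apply: val_inj; by rewrite /= modnMml mul1n.
Qed.

Lemma Zpm1_mulz_eq0 (a : int) : (u *~ a == 0) = (p.-1%:Z %| a)%Z.
Proof.
have pE : p.-1 = p.-2.+1 by case: p p_prime => [|[]].
have natE n : (u *+ n == 0) = (p.-1 %| n)%N.
  by rewrite Zpm1_mulrn -val_eqE /= -pE.
rewrite dvdzE; case: a => n; first exact: natE.
by rewrite NegzE mulrNz oppr_eq0 [LHS]natE abszN.
Qed.

Lemma Zpm1_mulz_expp (a : int) (k : nat) : u *~ (a * p%:Z ^+ k) = u *~ a.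
Proof.
have up (v : int) : u *~ (v * p%:Z) = u *~ v.
  apply/eqP; rewrite -subr_eq0 -mulrzBr Zpm1_mulz_eq0.
  apply/dvdzP; exists v; rewrite -{2}[v]mulr1 -mulrBr.
  by rewrite -subn1 -subzn ?prime_gt0.
by elim: k => [|k IH]; rewrite ?mulr1// exprSr mulrA up.
Qed.

Lemma Hp_repr (x : Hp R p) :
  exists ak : int * nat, val x = ak.1%:~R / p%:R ^+ ak.2.
Proof. by have /Hp_predP[a [k xE]] := valP x; exists (a, k). Qed.

(** Reduction a / p^k |-> a modulo p - 1; [residueE] shows that it does not
depend on the fraction chosen, as p acts trivially on Z / (p - 1). *)
Definition residue (x : Hp R p) : Zpm1 p := u *~ (projT1 (cid (Hp_repr x))).1.

Lemma residueE (x : Hp R p) (a : int) (k : nat) :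
  val x = a%:~R / p%:R ^+ k -> residue x = u *~ a.
Proof.
rewrite /residue; case: cid => -[b l] /= -> blak.
have pn0 n : p%:R ^+ n != 0 :> R by rewrite expf_neq0// natp_neq0.
rewrite -(Zpm1_mulz_expp b k) -(Zpm1_mulz_expp a l); congr (_ *~ _).
apply/eqP; rewrite -(eqr_int R) !intrM !rmorphXn /=.
by move/eqP: blak; rewrite eqr_div// => /eqP ->.
Qed.

Lemma residue_is_zmod_morphism : zmod_morphism residue.
Proof.
move=> x y; have [[a k] /= xE] := Hp_repr x; have [[b l] /= yE] := Hp_repr y.
have pn0 n : p%:R ^+ n != 0 :> R by rewrite expf_neq0// natp_neq0.
rewrite (@residueE (x - y) (a * p%:Z ^+ l - b * p%:Z ^+ k) (k + l)).
  by rewrite (residueE xE) (residueE yE) mulrzBr !Zpm1_mulz_expp.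
rewrite raddfB /= xE yE rmorphB /= !intrM !rmorphXn /= exprD.
by field; rewrite !pn0.
Qed.

HB.instance Definition _ := GRing.isZmodMorphism.Build (Hp R p) (Zpm1 p)
  residue residue_is_zmod_morphism.

Lemma residue_nat (n : nat) (x : Hp R p) : val x = n%:R -> residue x = inZp n.
Proof.
by move=> xn; rewrite (@residueE x n 0) ?expr0 ?divr1// -Zpm1_mulrn.
Qed.

Lemma Hp_nat_mem (n : nat) : n%:R \in @Hp_pred R p.
Proof. by apply/Hp_predP; exists n, 0%N; rewrite divr1. Qed.

Definition Hp_nat (n : nat) : Hp R p := exist _ n%:R (Hp_nat_mem n).

Lemma residue_surj (w : Zpm1 p) : exists x, residue x = w.
Proof.
by exists (Hp_nat w); rewrite (@residue_nat w)// valZpK.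
Qed.

Lemma residue_ker (x : Hp R p) : (x \in @pm1Hp R p) = (residue x == 0).
Proof.
have [[a k] /= xE] := Hp_repr x.
apply/asboolP/eqP => [[y ->]|/eqP].
  have [[b l] /= yE] := Hp_repr y.
  apply/eqP; rewrite raddfMn /= (residueE yE) pmulrn -mulrzA Zpm1_mulz_eq0.
  exact: dvdz_mull.
rewrite (residueE xE) Zpm1_mulz_eq0 => /dvdzP[b aE].
have yHp : b%:~R / p%:R ^+ k \in @Hp_pred R p by apply/Hp_predP; exists b, k.
exists (exist (fun y => y \in @Hp_pred R p) _ yHp); apply: val_inj; rewrite raddfMn /= xE aE.
by rewrite intrM -pmulrn mulrAC mulr_natr.
Qed.

End Residue.

(** * The Jacobian *)

Section Jacobian.
Variables (R : realType) (p : nat).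
Hypothesis p_prime : prime p.

Lemma residue_class : exists2 iota : {additive HpQ R p -> Zpm1 p}, bijective iota &
  forall x : Hp R p, iota (\pi_(HpQ R p) x) = residue x.
Proof.
exact: (first_isomorphism (residue_ker p_prime) (residue_surj R p_prime)).
Qed.

Definition Dirac_fun (t b : R) (H : Cp R p) : R :=
  if H == Cp_point p_prime t then rep H * b else 0.

Lemma Dirac_mem (t b : R) : b \in Hp_pred p -> Dirac_fun t b \in @divisor_pred R p.
Proof.
move=> bHp; apply/asboolP; split=> [H|].
  rewrite /Dirac_fun; case: ifP => _; last by have [] := set_mem (valP H).
  by rewrite (rep_scaleHp p_prime); exists b.
apply: (@sub_finite_set _ _ [set Cp_point p_prime t]) => // H.
by rewrite /Dirac_fun /=; case: (H =P _) => // _; rewrite eqxx.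
Qed.

(** Stated for every positive generator [l], in or out of [1, p[: replacing [l]
by its representative multiplies the coefficient by a power of p, which changes
neither the value l b nor the class of [b]. *)
Lemma Dirac_exists (l b : R) : 0 < l -> b \in Hp_pred p ->
  exists D : Div R p, deg D = l * b /\ chi D = cls p b.
Proof.
move=> l0 bHp; have [k lE] := fundP p_prime l0; pose t := fund p l.
have t1p : 1 <= t < p%:R := fund_itv p_prime l.
have cHp := Hp_mul_expz k bHp.
pose D : Div R p := exist (fun D => D \in @divisor_pred R p) _ (Dirac_mem t cHp).
have DE : val D = Dirac_fun t (p%:R ^ k * b) by [].
have ut : uniq [:: t] by [].
have t_itv x : x \in [:: t] -> 1 <= x < p%:R by rewrite inE => /eqP ->.
have D0 H : rep H \notin [:: t] -> val D H = 0.
  by rewrite inE DE /Dirac_fun; case: (H =P _) => // ->; rewrite Cp_pointK// eqxx.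
exists D; rewrite (deg_coord p_prime ut t_itv D0) (chi_coord p_prime ut t_itv D0).
rewrite !big_seq1 DE /Dirac_fun eqxx Cp_pointK// lE -mulrA; split=> //.
rewrite mulrAC mulfV ?mul1r ?(cls_expz p_prime)// gt_eqF//.
exact: fund_gt0.
Qed.

(** The same real 2 b is 1 times 2 b and 2 times b.  The argument is uniform in
p: for p = 2 the two subgroups coincide and the classes are all 0. *)
Lemma chi_deg0_surj (q : HpQ R p) : exists2 D : Div R p, deg D = 0 & chi D = q.
Proof.
elim/quotP: q => b _; rewrite -cls_val; have bHp := valP b.
have [D [degD chiD]] := Dirac_exists ltr01 (rpredMn 2 bHp).
have [E [degE chiE]] := Dirac_exists (ltr0n R 2) bHp.
exists (D - E); first by rewrite raddfB /= degD degE mul1r mulr_natl subrr.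
rewrite (chi_is_zmod_morphism p_prime) chiD chiE.
by rewrite mulr2n (clsD bHp bHp) addrK.
Qed.

(** The first isomorphism theorem for [chi] on degree 0 divisors, whose kernel
is exactly the principal ones. *)
Lemma jacobian_class (W : zmodType) (iota : {additive HpQ R p -> W}) :
  bijective iota ->
  exists2 chibar : {additive Jac R p -> W}, bijective chibar &
    forall D : Div0 R p, chibar (\pi_(Jac R p) D) = iota (chi (val D)).
Proof.
move=> iota_bij; pose chi0 (D : Div0 R p) := iota (chi (val D)).
have chi0B : zmod_morphism chi0.
  move=> D E; rewrite /chi0 [val (D - E)]raddfB.
  by rewrite (chi_is_zmod_morphism p_prime) raddfB.
pose cadd := GRing.isZmodMorphism.Build (Div0 R p) W chi0 chi0B.
pose C : {additive Div0 R p -> W} := HB.pack chi0 cadd.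
have Cker D : (D \in @principal_pred R p) = (C D == 0).
  apply/asboolP/eqP => [[f f_sec DE]|].
    have [_ chiD] := principal_deg_chi p_prime f_sec DE.
    by rewrite -[LHS]/(iota _) chiD raddf0.
  rewrite -[X in X = _]/(iota _) -[RHS](raddf0 iota) => /(bij_inj iota_bij).
  by apply: principal_of_deg_chi => //; have /eqP := valP D.
have Csurj w : exists D, C D = w.
  have [inv _ invK] := iota_bij; have [D degD chiD] := chi_deg0_surj (inv w).
  have D0 : D \in @deg0_pred R p by apply/eqP.
  by exists (exist _ D D0); rewrite -[LHS]/(iota (chi D)) chiD invK.
exact: (first_isomorphism Cker Csurj).
Qed.

End Jacobian.

Theorem theorem6p5 (R : realType) (p : nat) (p_prime : prime p) :
  [/\ forall f : R -> R, global_section p f ->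
        exists D : Div0 R p, forall H : Cp R p, val (val D) H = Order f H,
      forall D : Div R p, principal D -> chi D = 0
    & exists iota : {additive HpQ R p -> Zpm1 p},
      [/\ bijective iota,
          forall (n : nat) (x : Hp R p), val x = n%:R ->
            iota (\pi_(HpQ R p) x) = inZp n
        & exists2 chibar : {additive Jac R p -> Zpm1 p}, bijective chibar &
            forall D : Div0 R p,
              chibar (\pi_(Jac R p) D) = iota (chi (val D))]].
Proof.
split.
- move=> f f_sec; have [D DE] := Order_divisor p_prime f_sec.
  have [/eqP D0 _] := principal_deg_chi p_prime f_sec DE.
  by exists (exist (fun D => D \in @deg0_pred R p) D D0).
- by move=> D [f f_sec DE]; have [] := principal_deg_chi p_prime f_sec DE.
have [iota iota_bij iotaE] := residue_class R p_prime.
exists iota; split=> // [n x xn|]; last exact: jacobian_class.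
by rewrite iotaE (residue_nat p_prime xn).
Qed.
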